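(* (Convolutional self-similarity of the $q$-Hahn measure.) Let $0<q<1$ and let $N\ge0$ be an integer. (1) Let $0<a_1<1$, $0<a_2<1$, $b_1<1$. Then for all integers $0\le x\le N$, $$\sum_{z=0}^x\pi(x-z,N-z,a_1,b_1)\,\pi(z,N,a_2,a_1b_1)=\pi(x,N,a_1a_2,b_1),$$ and for all integers $0\le y\le x\le N$, $$\sum_{z=y}^x\pi(x-z,N-z,a_1,b_1)\,\pi(z-y,N-y,a_2,a_1b_1)=\sum_{z=y}^x\pi(x-z,N-z,a_2,a_1b_1)\,\pi(z-y,N-y,a_1,b_1)=\pi(x-y,N-y,a_1a_2,b_1).$$ (2) Let $0<a_1<1$, $0<b_1<1$, $b_2<1$. Then for all integers $0\le x\le y$, $$\sum_{z=x}^y\pi(x,z,a_1,b_1)\,\pi(z,y,a_1b_1,b_2)=\sum_{z=x}^y\pi(x,z,a_1b_1,b_2)\,\pi(z,y,a_1,b_1)=\pi(x,y,a_1,b_1b_2).$$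
   Context: $(a;q)_n=\prod_{i=0}^{n-1}(1-aq^i)$. The $q$-Hahn measure with parameters $0<a<1$, $b<1$ is, for integers $0\le x\le M$, $\pi(x,M,a,b)=\frac{(q;q)_M}{(q;q)_x(q;q)_{M-x}}\frac{(a;q)_x(b;q)_{M-x}a^{M-x}}{(ab;q)_M}$. *)

(* Defs.v *)
(* All identities are algebraic, so scalars range over an arbitrary
   realFieldType, which includes the real numbers. *)
From mathcomp Require Import all_boot all_order all_algebra.

Set Implicit Arguments.
Unset Strict Implicit.
Unset Printing Implicit Defensive.

Import Order.TTheory GRing.Theory Num.Theory.
Local Open Scope ring_scope.

Definition qpoch (R : realFieldType) (a q : R) (n : nat) : R :=
  \prod_(i < n) (1 - a * q ^+ i).

(* The weight pi(x, M, a, b) of the q-Hahn measure, with q explicit.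
   Only meaningful for x <= M, since M - x is truncated. *)
Definition qHahn (R : realFieldType) (q : R) (x M : nat) (a b : R) : R :=
  qpoch q q M / (qpoch q q x * qpoch q q (M - x)) *
  (qpoch a q x * qpoch b q (M - x) * a ^+ (M - x) / qpoch (a * b) q M).

(* Main.v *)
(** Cancelling the factors that do not depend on the summation index reduces
    every sum to the q-Saalschuetz identity
      sum_k [n,k] (a)_{n-k} (b)_k (c)_k a^k (a b c q^k)_{n-k} = (ab)_n (ac)_n,
    or to its case c = 0, the q-Chu-Vandermonde identity.  The q-Saalschuetz
    identity is proved by creative telescoping: writing f(i, k) for the k-th
    summand divided by (q)_n, with i = n - k, and
      g(i, k) = a q^i (1 - b q^k) (1 - c q^k) f(i, k),
    one has
      (1 - q^(n+1)) f(i+1, k)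
        = (1 - a b q^n) (1 - a c q^n) f(i, k) - g(i, k) + g(i+1, k-1). *)
Require Import Defs.
From mathcomp Require Import all_boot all_order all_algebra.
From mathcomp Require Import ring lra zify.

Set Implicit Arguments.
Unset Strict Implicit.
Unset Printing Implicit Defensive.

Import Order.TTheory GRing.Theory Num.Theory.
Local Open Scope ring_scope.

(** * Splitting and nonvanishing of q-Pochhammer symbols *)

Section QPochhammer.
Variable R : realFieldType.
Implicit Types (a b c q : R) (i j k m n x y z : nat).

Lemma qpoch0 a q : qpoch a q 0 = 1.
Proof. by rewrite /qpoch big_ord0. Qed.

Lemma qpochS a q n : qpoch a q n.+1 = qpoch a q n * (1 - a * q ^+ n).
Proof. by rewrite /qpoch big_ord_recr. Qed.

Lemma qpochD a q m n :
  qpoch a q (m + n) = qpoch a q m * qpoch (a * q ^+ m) q n.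
Proof.
elim: n => [|n IHn]; first by rewrite addn0 qpoch0 mulr1.
by rewrite addnS !qpochS IHn exprD !mulrA.
Qed.

Lemma qpochSl a q n : qpoch a q n.+1 = (1 - a) * qpoch (a * q) q n.
Proof. by rewrite -add1n qpochD qpochS qpoch0 mul1r expr0 mulr1 expr1. Qed.

Lemma qpoch_0l q n : qpoch 0 q n = 1.
Proof. by rewrite /qpoch big1 // => i _; rewrite mul0r subr0. Qed.

Lemma mulr_lt1 a b : 0 < a < 1 -> b < 1 -> a * b < 1.
Proof. by case/andP=> a0 a1 b1; nra. Qed.

(** Since [0 < q ^+ i <= 1], the bound [a < 1] gives [a * q ^+ i < 1] whatever the sign of [a], so
    no factor vanishes. This clears every denominator below. *)
Lemma qpoch_neq0 a q n : 0 < q < 1 -> a < 1 -> qpoch a q n != 0.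
Proof.
move=> /andP[q0 q1] a1; apply/prodf_neq0 => i _.
rewrite subr_eq0 eq_sym lt_eqF //.
have q_i0 : 0 < q ^+ i by rewrite exprn_gt0.
have q_i1 : q ^+ i <= 1 by rewrite exprn_ile1 // ltW.
by nra.
Qed.

(** The f(i, k) of the overview; independent indices keep truncated subtraction out of the
    recurrences. *)
Definition saal_term a b c q i k : R :=
  qpoch a q i * qpoch b q k * qpoch c q k * a ^+ k *
  qpoch (a * b * c * q ^+ k) q i / (qpoch q q i * qpoch q q k).

Definition saal_cert a b c q i k : R :=
  a * q ^+ i * (1 - b * q ^+ k) * (1 - c * q ^+ k) * saal_term a b c q i k.

(** * The q-Saalschuetz sum by telescoping *)

Section Saalschuetz.
Variables a b c q : R.
Hypothesis q01 : 0 < q < 1.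

Let q_lt1 : q < 1. Proof. by case/andP: q01. Qed.

Let qq_neq0 n : qpoch q q n != 0.
Proof. exact: qpoch_neq0. Qed.

Let q_neq0 n : 1 - q * q ^+ n != 0.
Proof. by have := qq_neq0 n.+1; rewrite qpochS mulf_eq0 negb_or => /andP[]. Qed.

(** The edge k = 0 of the recurrence, where g(i+1, -1) counts as 0. *)
Lemma saal_term_rec0 i :
  (1 - q ^+ i.+1) * saal_term a b c q i.+1 0 =
  (1 - a * b * q ^+ i) * (1 - a * c * q ^+ i) * saal_term a b c q i 0
  - saal_cert a b c q i 0.
Proof.
rewrite /saal_cert /saal_term !qpoch0 !expr0 !qpochS exprS.
by field; rewrite qq_neq0 q_neq0.
Qed.

Lemma saal_term_recS i k :
  (1 - q ^+ (i + k).+2) * saal_term a b c q i.+1 k.+1 =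
  (1 - a * b * q ^+ (i + k.+1)) * (1 - a * c * q ^+ (i + k.+1)) *
    saal_term a b c q i k.+1
  - saal_cert a b c q i k.+1 + saal_cert a b c q i.+1 k.
Proof.
(* The symbol in g(i+1, k) starts at a b c q^k, the others at a b c q^(k+1). Peeling off its first
   factor makes all symbols proportional, which leaves a rational identity. *)
have split_low :
    qpoch (a * b * c * q ^+ k) q i.+1 =
    (1 - a * b * c * q ^+ k) * qpoch (a * b * c * q ^+ k.+1) q i.
  by rewrite qpochSl exprSr mulrA.
rewrite /saal_cert /saal_term split_low !qpochS !exprS addnS !exprS !exprD.
by field; rewrite !qq_neq0 !q_neq0.
Qed.

(** The edge i = -1 of the recurrence, where f(-1, k+1) and g(-1, k+1) count as 0. *)
Lemma saal_term_last k :
  (1 - q ^+ k.+1) * saal_term a b c q 0 k.+1 = saal_cert a b c q 0 k.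
Proof.
rewrite /saal_cert /saal_term !qpoch0 !qpochS !exprS expr0.
by field; rewrite qq_neq0 q_neq0.
Qed.

(** The certificates cancel between neighbouring k, so stopping at [m] leaves only the last one. For
    [m = n] it is g(0, n), which [saal_term_last] supplies as the missing term k = n+1. *)
Lemma saal_partial_sum n m : (m <= n)%N ->
  (1 - q ^+ n.+1) * (\sum_(0 <= k < m.+1) saal_term a b c q (n.+1 - k) k) =
  (1 - a * b * q ^+ n) * (1 - a * c * q ^+ n) *
    (\sum_(0 <= k < m.+1) saal_term a b c q (n - k) k)
  - saal_cert a b c q (n - m) m.
Proof.
elim: m => [_|m IHm lt_mn].
  by rewrite !big_nat1 !subn0 saal_term_rec0.
rewrite big_nat_recr //= [in RHS]big_nat_recr //= !mulrDr (IHm (ltnW lt_mn)).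
rewrite subSS -(subnSK lt_mn).
have := saal_term_recS (n - m.+1) m.
rewrite -addnS subnK // => ->.
by ring.
Qed.

Lemma q_saalschuetz n :
  \sum_(0 <= k < n.+1) saal_term a b c q (n - k) k =
  qpoch (a * b) q n * qpoch (a * c) q n / qpoch q q n.
Proof.
elim: n => [|n IHn].
  by rewrite big_nat1 /saal_term !qpoch0 expr0 !mulr1.
have nz : 1 - q ^+ n.+1 != 0 by rewrite exprS.
apply: (mulfI nz).
rewrite big_nat_recr //= mulrDr saal_partial_sum // IHn !subnn saal_term_last.
rewrite subrK !qpochS exprS.
by field; rewrite qq_neq0 q_neq0.
Qed.

(** For sums whose running index is the first index of [saal_term]. *)
Lemma q_saalschuetz_rev n :
  \sum_(0 <= k < n.+1) saal_term a b c q k (n - k) =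
  qpoch (a * b) q n * qpoch (a * c) q n / qpoch q q n.
Proof.
rewrite -q_saalschuetz big_nat_rev /=; apply: eq_big_nat => k /andP[_ lt_kn].
by rewrite add0n subSS subKn.
Qed.

End Saalschuetz.

End QPochhammer.

(** * The four convolution sums *)

Section Convolution.
Variables (R : realFieldType) (q : R).
Hypothesis q01 : 0 < q < 1.
Implicit Types (a b : R) (m n x y : nat).

Let q_lt1 : q < 1. Proof. by case/andP: q01. Qed.

Lemma qHahnE x m a b :
  qHahn q x (m + x) a b =
  qpoch q q (m + x) / (qpoch q q x * qpoch q q m) *
  (qpoch a q x * qpoch b q m * a ^+ m / qpoch (a * b) q (m + x)).
Proof. by rewrite /qHahn addnK. Qed.

(** With k = n - z, the factors (q)_(m+k) and (a1 b1)_(m+k) cancel between the two weights, leaving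
    q-Chu-Vandermonde. *)
Lemma qHahn_convl n m a1 a2 b1 : 0 < a1 < 1 -> 0 < a2 < 1 -> b1 < 1 ->
  \sum_(0 <= z < n.+1)
     qHahn q (n - z) (m + n - z) a1 b1 * qHahn q z (m + n) a2 (a1 * b1)
  = qHahn q n (m + n) (a1 * a2) b1.
Proof.
move=> a1P a2P b1P.
have ab := mulr_lt1 a1P b1P; have aab := mulr_lt1 a2P ab.
have nz := qpoch_neq0 _ q01.
pose C := qpoch q q (m + n) / qpoch q q m * qpoch b1 q m * (a1 * a2) ^+ m /
          qpoch (a2 * (a1 * b1)) q (m + n).
transitivity (C * \sum_(0 <= z < n.+1) saal_term a2 a1 0 q z (n - z)).
  rewrite mulr_sumr /C; apply: eq_big_nat => z /andP[_]; rewrite ltnS => le_zn.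
  rewrite -(subnK le_zn); move: (n - z)%N => k.
  rewrite addnA !addnK qHahnE qHahnE -addnA /saal_term.
  rewrite mulr0 mul0r !qpoch_0l exprD exprMn addnA.
  by field; rewrite !nz.
rewrite q_saalschuetz_rev // mulr0 qpoch_0l qHahnE /C.
rewrite (_ : a1 * a2 * b1 = a2 * (a1 * b1)); last by ring.
rewrite [a1 * a2]mulrC.
by field; rewrite !nz.
Qed.

Lemma qHahn_convl_swap n m a1 a2 b1 : 0 < a1 < 1 -> 0 < a2 < 1 -> b1 < 1 ->
  \sum_(0 <= z < n.+1)
     qHahn q (n - z) (m + n - z) a2 (a1 * b1) * qHahn q z (m + n) a1 b1
  = qHahn q n (m + n) (a1 * a2) b1.
Proof.
move=> a1P a2P b1P.
have ab := mulr_lt1 a1P b1P; have aab := mulr_lt1 a2P ab.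
have nz := qpoch_neq0 _ q01.
(* Now (b1)_(m+k) = (b1)_m (b1 q^m)_k produces c = b1 q^m, and 1/(a1 a2 b1)_(m+k) becomes (a1 a2 b1
   q^(m+k))_z / (a1 a2 b1)_(m+n). *)
pose C := qpoch q q (m + n) / qpoch q q m * qpoch (a1 * b1) q m *
          (a1 * a2) ^+ m * qpoch b1 q m /
          (qpoch (a1 * b1) q (m + n) * qpoch (a2 * (a1 * b1)) q (m + n)).
transitivity
  (C * \sum_(0 <= z < n.+1) saal_term a1 a2 (b1 * q ^+ m) q z (n - z)).
  rewrite mulr_sumr /C; apply: eq_big_nat => z /andP[_]; rewrite ltnS => le_zn.
  rewrite -(subnK le_zn); move: (n - z)%N => k.
  rewrite addnA !addnK qHahnE qHahnE /saal_term.
  have -> : a1 * a2 * (b1 * q ^+ m) * q ^+ k = a2 * (a1 * b1) * q ^+ (m + k).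
    by rewrite exprD; ring.
  have nzaab := nz (a2 * (a1 * b1)) (m + k + z)%N aab.
  move: nzaab; rewrite [qpoch (a2 * _) q (m + k + z)]qpochD.
  rewrite mulf_eq0 negb_or => /andP[nz1 nz2].
  rewrite [qpoch b1 q (m + k)]qpochD !exprD !exprMn.
  by field; rewrite -exprD nz2 !nz.
rewrite q_saalschuetz_rev // qHahnE /C.
rewrite (_ : a1 * a2 * b1 = a2 * (a1 * b1)); last by ring.
rewrite [qpoch (a1 * b1) q (m + n)]qpochD [a1 * (b1 * _)]mulrA.
have := nz (a1 * b1) (m + n)%N ab; rewrite qpochD mulf_eq0 negb_or.
case/andP=> nz1 nz2.
by field; rewrite nz2 !nz.
Qed.

Lemma qHahn_convr n x a1 b1 b2 : 0 < a1 < 1 -> 0 < b1 < 1 -> b2 < 1 ->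
  \sum_(0 <= k < n.+1)
     qHahn q x (k + x) a1 b1 * qHahn q (k + x) (n + x) (a1 * b1) b2
  = qHahn q x (n + x) a1 (b1 * b2).
Proof.
move=> a1P b1P b2P.
have ab : a1 * b1 < 1 by apply: mulr_lt1 => //; case/andP: b1P.
have abb : a1 * (b1 * b2) < 1 by apply: mulr_lt1 => //; apply: mulr_lt1.
have nz := qpoch_neq0 _ q01.
pose C := qpoch q q (n + x) / qpoch q q x * qpoch a1 q x * a1 ^+ n /
          qpoch (a1 * (b1 * b2)) q (n + x).
transitivity (C * \sum_(0 <= k < n.+1) saal_term b1 b2 0 q k (n - k)).
  rewrite mulr_sumr /C; apply: eq_big_nat => k /andP[_]; rewrite ltnS => le_kn.
  rewrite -(subnK le_kn); move: (n - k)%N => j.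
  rewrite !addnK -addnA !qHahnE /saal_term mulr0 mul0r !qpoch_0l addnA.
  rewrite -[a1 * b1 * b2]mulrA !exprD !exprMn.
  by field; rewrite !nz.
rewrite q_saalschuetz_rev // mulr0 qpoch_0l qHahnE /C.
by field; rewrite !nz.
Qed.

Lemma qHahn_convr_swap n x a1 b1 b2 : 0 < a1 < 1 -> 0 < b1 < 1 -> b2 < 1 ->
  \sum_(0 <= k < n.+1)
     qHahn q x (k + x) (a1 * b1) b2 * qHahn q (k + x) (n + x) a1 b1
  = qHahn q x (n + x) a1 (b1 * b2).
Proof.
move=> a1P b1P b2P.
have ab : a1 * b1 < 1 by apply: mulr_lt1 => //; case/andP: b1P.
have abb : a1 * (b1 * b2) < 1 by apply: mulr_lt1 => //; apply: mulr_lt1.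
have nz := qpoch_neq0 _ q01.
(* Here (a1)_(k+x) = (a1)_x (a1 q^x)_k produces c = a1 q^x. *)
pose C := qpoch q q (n + x) / qpoch q q x * qpoch (a1 * b1) q x * a1 ^+ n *
          qpoch a1 q x /
          (qpoch (a1 * b1) q (n + x) * qpoch (a1 * (b1 * b2)) q (n + x)).
transitivity
  (C * \sum_(0 <= k < n.+1) saal_term b1 b2 (a1 * q ^+ x) q (n - k) k).
  rewrite mulr_sumr /C; apply: eq_big_nat => k /andP[_]; rewrite ltnS => le_kn.
  rewrite -(subnKC le_kn); move: (n - k)%N => j.
  rewrite addKn [(k + j)%N]addnC -addnA !qHahnE /saal_term.
  have -> : b1 * b2 * (a1 * q ^+ x) * q ^+ k = a1 * (b1 * b2) * q ^+ (k + x).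
    by rewrite exprD; ring.
  rewrite -[a1 * b1 * b2]mulrA.
  have := nz (a1 * (b1 * b2)) (k + x + j)%N abb.
  rewrite [(j + (k + x))%N]addnC [qpoch (a1 * (b1 * b2)) q (k + x + j)]qpochD.
  rewrite mulf_eq0 negb_or => /andP[nz1 nz2].
  have -> : qpoch a1 q (k + x) = qpoch a1 q x * qpoch (a1 * q ^+ x) q k.
    by rewrite addnC qpochD.
  rewrite !exprD !exprMn.
  by field; rewrite -exprD nz2 !nz.
rewrite q_saalschuetz // qHahnE /C.
have nzab := nz (a1 * b1) (n + x)%N ab.
move: nzab; rewrite [in qpoch (a1 * b1) q _]addnC qpochD.
rewrite mulf_eq0 negb_or => /andP[nz1 nz2].
rewrite (_ : b1 * (a1 * q ^+ x) = a1 * b1 * q ^+ x); last by ring.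
by field; rewrite nz2 !nz.
Qed.

End Convolution.

Theorem mainTheorem19 (R : realFieldType) (q : R) (N : nat)
    (q_gt0 : 0 < q) (q_lt1 : q < 1) :
  (forall a1 a2 b1 : R, 0 < a1 < 1 -> 0 < a2 < 1 -> b1 < 1 ->
     (forall x : nat, (x <= N)%N ->
        \sum_(0 <= z < x.+1)
           qHahn q (x - z) (N - z) a1 b1 * qHahn q z N a2 (a1 * b1)
        = qHahn q x N (a1 * a2) b1)
     /\
     (forall x y : nat, (y <= x)%N -> (x <= N)%N ->
        \sum_(y <= z < x.+1)
           qHahn q (x - z) (N - z) a1 b1 *
           qHahn q (z - y) (N - y) a2 (a1 * b1)
        = \sum_(y <= z < x.+1)
           qHahn q (x - z) (N - z) a2 (a1 * b1) *
           qHahn q (z - y) (N - y) a1 b1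
        /\
        \sum_(y <= z < x.+1)
           qHahn q (x - z) (N - z) a2 (a1 * b1) *
           qHahn q (z - y) (N - y) a1 b1
        = qHahn q (x - y) (N - y) (a1 * a2) b1))
  /\
  (forall a1 b1 b2 : R, 0 < a1 < 1 -> 0 < b1 < 1 -> b2 < 1 ->
     forall x y : nat, (x <= y)%N ->
        \sum_(x <= z < y.+1)
           qHahn q x z a1 b1 * qHahn q z y (a1 * b1) b2
        = \sum_(x <= z < y.+1)
           qHahn q x z (a1 * b1) b2 * qHahn q z y a1 b1
        /\
        \sum_(x <= z < y.+1)
           qHahn q x z (a1 * b1) b2 * qHahn q z y a1 b1
        = qHahn q x y a1 (b1 * b2)).
Proof.
have q01 : 0 < q < 1 by rewrite q_gt0.
have shift (x y : nat) (F : nat -> R) : (y <= x)%N ->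
    \sum_(y <= z < x.+1) F z = \sum_(0 <= k < (x - y).+1) F (k + y)%N.
  by move=> le_yx; rewrite -[y in LHS]add0n big_addn subSn.
split=> [a1 a2 b1 a1P a2P b1P | a1 b1 b2 a1P b1P b2P x y le_xy].
  split=> [x le_xN | x y le_yx le_xN].
    by rewrite -(subnK le_xN) qHahn_convl.
  (* Substituting z = k + y turns the sum into the case y = 0 with x - y and N - y in place of x and
     N. *)
  have shift_conv a b c d :
      \sum_(y <= z < x.+1)
         qHahn q (x - z) (N - z) a b * qHahn q (z - y) (N - y) c d =
      \sum_(0 <= k < (x - y).+1)
         qHahn q (x - y - k) (N - y - k) a b * qHahn q k (N - y) c d.
    rewrite shift //; apply: eq_bigr => k _.
    by rewrite addnK [(k + y)%N]addnC !subnDA.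
  rewrite !shift_conv.
  have -> : (N - y = N - x + (x - y))%N by lia.
  by rewrite qHahn_convl // qHahn_convl_swap.
rewrite !(shift y x) // -{2 4 6}(subnK le_xy).
by rewrite qHahn_convr // qHahn_convr_swap // subnK.
Qed.
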